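(* For all $n\ge1$, $a_{\{0101,0120\}}(n)=a_{\{101,120\}}(n)=|S_n(231,4123)|$. Moreover, with the convention $a_{\{0101,0120\}}(0)=1$, $$\sum_{n\ge0}a_{\{0101,0120\}}(n)\,x^n=\frac{(1-x)^3}{1-4x+5x^2-3x^3}.$$
   Context: An ascent in an integer sequence $s_1\cdots s_m$ is an index $j$ with $s_j<s_{j+1}$; $\mathrm{asc}$ denotes the number of ascents. An ascent sequence is a sequence $x_1\cdots x_n$ of nonnegative integers with $x_1=0$ and $x_i\le 1+\mathrm{asc}(x_1\cdots x_{i-1})$ for all $i\ge2$. The reduction $\mathrm{red}(w)$ of an integer sequence $w$ replaces the $i$-th smallest distinct letter of $w$ by $i-1$; a pattern is a reduced sequence. A sequence $x$ contains a pattern $p=p_1\cdots p_k$ if there are indices $i_1<\cdots<i_k$ with $\mathrm{red}(x_{i_1}\cdots x_{i_k})=p$; otherwise $x$ avoids $p$. For a finite set $P$ of patterns, $a_P(n)$ denotes the number of ascent sequences of length $n$ avoiding every pattern in $P$. $S_n(231,4123)$ is the set of permutations of $\{1,\dots,n\}$ avoiding (in the classical sense) both the permutation patterns $231$ and $4123$. *)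

(* Defs.v *)
From mathcomp Require Import all_boot all_order all_algebra all_fingroup.
Set Implicit Arguments. Unset Strict Implicit. Unset Printing Implicit Defensive.
Import GRing.Theory.

Definition asc (s : seq nat) : nat :=
  count (fun p : nat * nat => p.1 < p.2) (zip s (behead s)).

Definition is_ascent_seq (x : seq nat) : bool :=
  [forall i : 'I_(size x),
     nth 0 x i <= (if val i == 0 then 0 else (asc (take i x)).+1)].

Definition red (w : seq nat) : seq nat :=
  [seq size (undup (filter (fun b => b < a) w)) | a <- w].

Definition contains (w p : seq nat) : bool :=
  [exists m : (size w).-tuple bool, red (mask m w) == p].

Definition avoids_all (P : seq (seq nat)) (w : seq nat) : bool :=
  all (fun p => ~~ contains w p) P.

(* a_P(n): ascent sequences of length n avoiding every pattern of P.
   Entries of an ascent sequence of length n are < n, so we range over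
   n-tuples with entries in 'I_n. *)
Definition a_P (P : seq (seq nat)) (n : nat) : nat :=
  #|[set t : n.-tuple 'I_n | is_ascent_seq (map val t) && avoids_all P (map val t)]|.

Definition perm_word n (s : 'S_n) : seq nat := [seq (val (s i)).+1 | i <- enum 'I_n].

(* classical containment of a permutation pattern q (given in one-line
   notation on {1..k}) *)
Definition perm_contains n (s : 'S_n) (q : seq nat) : bool :=
  contains (perm_word s) (red q).

Definition S_231_4123 n : {set 'S_n} :=
  [set s : 'S_n | ~~ perm_contains s [:: 2; 3; 1] && ~~ perm_contains s [:: 4; 1; 2; 3]].

Definition c_seq (n : nat) : int :=
  if n == 0 then Posz 1 else Posz (a_P [:: [:: 0; 1; 0; 1]; [:: 0; 1; 2; 0]] n).

(* Main.v *)
Require Import Defs.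
From mathcomp Require Import all_boot all_order all_algebra all_fingroup.
From mathcomp Require Import zify ring.
Set Implicit Arguments. Unset Strict Implicit. Unset Printing Implicit Defensive.

(** In an ascent sequence avoiding 0101 or 101 every ascent creates a new
    maximum, so it is a restricted growth function; prepending the smallest
    letter of a pattern occurrence then shows that {0101, 0120} and {101, 120}
    are avoided by the same sequences. If [m] is the current maximum, avoiding
    120 forces the next letter to be [m - 1], [m] or [m + 1], and avoiding 101
    forbids exactly the letters that are already followed by a smaller one.
    A finite automaton whose states record whether [m] and [m - 1] are still
    usable therefore recognizes these sequences.

    A permutation avoiding 231 and 4123 is a word [a S G] with [S < a < G],
    where [S] avoids 231 and 123 and [G] avoids 231 and 4123. There are
    1 + binomial(j, 2) choices for [S] of length [j], and the resulting
    convolution recurrence has the same solution as the automaton. *)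

(** * Patterns *)

Lemma containsP (w p : seq nat) :
  reflect (exists2 s, subseq s w & red s = p) (contains w p).
Proof.
apply: (iffP existsP) => [[m /eqP redm]|[s /subseqP[m szm ->] reds]].
  by exists (mask m w) => //; apply: mask_subseq.
by exists (tcast szm (in_tuple m)); rewrite val_tcast reds.
Qed.

Lemma contains_subseq (u w p : seq nat) :
  subseq u w -> contains u p -> contains w p.
Proof.
move=> uw /containsP[s su redp]; apply/containsP; exists s => //.
exact: subseq_trans uw.
Qed.

Lemma avoids_all_subseq P (u w : seq nat) :
  subseq u w -> avoids_all P w -> avoids_all P u.
Proof.
move=> uw /allP avw; apply/allP => p /avw; apply: contra.
exact: contains_subseq.
Qed.

(** The reduced value of a letter is the number of distinct smaller letters. If [x < y], that set
    for [y] contains the one for [x] together with [x] itself. *)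
Lemma ltn_red (w : seq nat) i j : i < size w -> j < size w ->
  (nth 0 (red w) i < nth 0 (red w) j) = (nth 0 w i < nth 0 w j).
Proof.
move=> iw jw; rewrite !(nth_map 0) //.
set x := nth 0 w i; set y := nth 0 w j.
have xw : x \in w by apply: mem_nth.
have le a b : a <= b -> size (undup [seq c <- w | c < a]) <=
                        size (undup [seq c <- w | c < b]).
  move=> ab; apply: uniq_leq_size; first exact: undup_uniq.
  move=> c; rewrite !mem_undup !mem_filter => /andP[ca ->].
  by rewrite (leq_trans ca).
case: (ltnP x y) => [xy|yx]; last by rewrite ltnNge le.
rewrite -[_.+1]/(size (x :: undup [seq c <- w | c < x])).
apply: uniq_leq_size => [|c].
  by rewrite /= undup_uniq mem_undup mem_filter ltnn.
rewrite inE !mem_undup !mem_filter => /predU1P[->|/andP[cx ->]].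
  by rewrite xy.
by rewrite (ltn_trans cx xy).
Qed.

Lemma size_red w : size (red w) = size w.
Proof. exact: size_map. Qed.

(** Evaluates [red] on letters that are variables: [lia] settles first the comparisons made by the
    filters, then the equality tests made by [undup]. *)
Ltac compute_red := rewrite /red /=;
  repeat (match goal with |- context [leq (S ?a) ?b] =>
    first [have -> : (a < b) = true by lia
          | have -> : (a < b) = false by lia] end; rewrite /=);
  rewrite ?inE;
  repeat (match goal with |- context [@eq_op ?T ?a ?b] =>
    first [have -> : (@eq_op T a b) = true by lia
          | have -> : (@eq_op T a b) = false by lia] end; rewrite /=).

Lemma red3P p s : red s = p -> size p = 3 -> exists x y z, s = [:: x; y; z].
Proof.
by move=> <-; rewrite size_red; case: s => [|x [|y [|z []]]] // _; exists x, y, z.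
Qed.

Lemma red4P p s : red s = p -> size p = 4 ->
  exists x y z t, s = [:: x; y; z; t].
Proof.
move=> <-; rewrite size_red; case: s => [|x [|y [|z [|t []]]]] // _.
by exists x, y, z, t.
Qed.

Lemma contains101P w : reflect (exists x y, y < x /\ subseq [:: x; y; x] w)
  (contains w [:: 1; 0; 1]).
Proof.
apply: (iffP (containsP _ _)) => [[s sw rs]|[x [y [yx sw]]]].
  have [x [y [z def_s]]] := red3P rs erefl; subst s.
  (* Each instance of [h] has a comparison of pattern literals on its left, which evaluates.
     Equality of two letters comes from two failed strict comparisons. *)
  have h i j := @ltn_red [:: x; y; z] i j; rewrite rs in h.
  have := h 1 0 isT isT; have := h 0 2 isT isT; have := h 2 0 isT isT.
  move=> /= zx xz yx; exists x, y; split; first by rewrite -yx.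
  by have -> : [:: x; y; x] = [:: x; y; z] by do 3 f_equal; lia.
by exists [:: x; y; x] => //; compute_red.
Qed.

Lemma contains120P w :
  reflect (exists x y z, [/\ z < x, x < y & subseq [:: x; y; z] w])
  (contains w [:: 1; 2; 0]).
Proof.
apply: (iffP (containsP _ _)) => [[s sw rs]|[x [y [z [zx xy sw]]]]].
  have [x [y [z def_s]]] := red3P rs erefl; subst s.
  have h i j := @ltn_red [:: x; y; z] i j; rewrite rs in h.
  have := h 0 1 isT isT; have := h 2 0 isT isT.
  by move=> /= zx yx; exists x, y, z; split => //; rewrite -?zx -?yx.
by exists [:: x; y; z] => //; compute_red.
Qed.

Lemma contains0101P w : reflect (exists x y, y < x /\ subseq [:: y; x; y; x] w)
  (contains w [:: 0; 1; 0; 1]).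
Proof.
apply: (iffP (containsP _ _)) => [[s sw rs]|[x [y [yx sw]]]].
  have [t [x [y [z def_s]]]] := red4P rs erefl; subst s.
  have h i j := @ltn_red [:: t; x; y; z] i j; rewrite rs in h.
  have := h 2 1 isT isT; have := h 1 3 isT isT; have := h 3 1 isT isT.
  have := h 0 2 isT isT; have := h 2 0 isT isT.
  move=> /= yt ty zx xz yx; exists x, y; split; first by rewrite -yx.
  have -> // : [:: y; x; y; x] = [:: t; x; y; z].
  by congr [:: _; _; _; _]; lia.
by exists [:: y; x; y; x] => //; compute_red.
Qed.

Lemma contains0120P w :
  reflect (exists x y z, [/\ z < x, x < y & subseq [:: z; x; y; z] w])
  (contains w [:: 0; 1; 2; 0]).
Proof.
apply: (iffP (containsP _ _)) => [[s sw rs]|[x [y [z [zx xy sw]]]]].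
  have [t [x [y [z def_s]]]] := red4P rs erefl; subst s.
  have h i j := @ltn_red [:: t; x; y; z] i j; rewrite rs in h.
  have := h 1 2 isT isT; have := h 3 1 isT isT.
  have := h 0 3 isT isT; have := h 3 0 isT isT.
  move=> /= zt tz zx yx; exists x, y, z; split; rewrite -?zx -?yx //.
  have -> // : [:: z; x; y; z] = [:: t; x; y; z].
  by congr [:: _; _; _; _]; lia.
by exists [:: z; x; y; z] => //; compute_red.
Qed.

Lemma contains3012P w :
  reflect (exists t x y z,
             [/\ x < y, y < z, z < t & subseq [:: t; x; y; z] w])
  (contains w [:: 3; 0; 1; 2]).
Proof.
apply: (iffP (containsP _ _)) => [[s sw rs]|[t [x [y [z [xy yz zt sw]]]]]].
  have [t [x [y [z def_s]]]] := red4P rs erefl; subst s.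
  have h i j := @ltn_red [:: t; x; y; z] i j; rewrite rs in h.
  have := h 1 2 isT isT; have := h 2 3 isT isT; have := h 3 0 isT isT.
  by move=> /= tz yz xy; exists t, x, y, z; split; rewrite -?tz -?xy -?yz.
by exists [:: t; x; y; z] => //; compute_red.
Qed.

(** * Cardinality of predicates *)

(** Words over [nat] do not form a finite type, so their sets are counted by duplicate-free
    enumerations. *)
Definition has_card (T : eqType) (P : pred T) (n : nat) :=
  exists s : seq T, [/\ uniq s, s =i P & size s = n].

Lemma eq_has_card (T : eqType) (P Q : pred T) n :
  P =1 Q -> has_card P n -> has_card Q n.
Proof. by move=> PQ [s [us sP sn]]; exists s; split=> // x; rewrite sP; apply: PQ. Qed.

Lemma has_card0 (T : eqType) (P : pred T) : P =1 pred0 -> has_card P 0.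
Proof. by move=> P0; exists [::]; split=> // x; rewrite in_nil -[RHS]/(P x) P0. Qed.

Lemma has_card1 (T : eqType) (x : T) : has_card (pred1 x) 1.
Proof. by exists [:: x]; split=> // y; rewrite inE. Qed.

Lemma has_cardU (T : eqType) (P Q : pred T) m n :
    (forall x, P x -> ~~ Q x) -> has_card P m -> has_card Q n ->
  has_card (fun x => P x || Q x) (m + n).
Proof.
move=> PQ [s [us sP <-]] [t [ut tQ <-]]; exists (s ++ t).
rewrite size_cat cat_uniq us ut andbT; split=> //.
  by apply/hasPn => x; rewrite tQ sP; apply: contraL => /PQ.
by move=> x; rewrite mem_cat sP tQ.
Qed.

Lemma has_card_image (T U : eqType) (P : pred T) (Q : pred U) (f : T -> U) n :
    {in P &, injective f} ->
    (forall y, reflect (exists2 x, P x & f x = y) (Q y)) ->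
  has_card P n -> has_card Q n.
Proof.
move=> injf Qf [s [us sP <-]]; exists (map f s); rewrite size_map; split=> //.
  by rewrite map_inj_in_uniq // => x y; rewrite !sP => Px Py /injf; apply.
move=> y; apply/mapP/Qf => [[x xs ->]|[x Px <-]]; last by exists x; rewrite ?sP.
by exists x => //; have := sP x; rewrite xs.
Qed.

Lemma has_cardX (T U : eqType) (P : pred T) (Q : pred U) m n :
  has_card P m -> has_card Q n ->
  has_card (fun z : T * U => P z.1 && Q z.2) (m * n).
Proof.
move=> [s [us sP <-]] [t [ut tQ <-]]; exists [seq (x, y) | x <- s, y <- t].
rewrite size_allpairs allpairs_uniq //; last by case=> [? ?] [? ?].
split=> // -[x y]; rewrite -[RHS]/(P x && Q y).
apply/allpairsP/andP => [[[a b] /= [as_ bt [-> ->]]]|[Px Qy]].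
  by have := sP a; have := tQ b; rewrite as_ bt.
by exists (x, y); rewrite /= sP tQ.
Qed.

(** The bridge from counts of words to the finite cardinals in the theorem, for tuples and for
    permutations. *)
Lemma card_has_card (T : finType) (P : pred T) (U : eqType) (f : T -> U)
    (Q : pred U) n :
    injective f -> (forall y, reflect (exists2 x, P x & f x = y) (Q y)) ->
  has_card Q n -> #|P| = n.
Proof.
move=> injf Qf [s [us sQ <-]]; rewrite cardE -(size_map f).
apply: perm_size; apply: uniq_perm => //.
  by rewrite map_inj_uniq ?enum_uniq.
move=> y; rewrite sQ; apply/mapP/Qf => [[x xP ->]|[x Px <-]].
  by exists x => //; move: xP; rewrite mem_enum.
by exists x; rewrite ?mem_enum.
Qed.

(** * Ascent sequences *)

Lemma subseq_rconsP (T : eqType) (s u : seq T) x : subseq s (rcons u x) ->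
  subseq s u \/ exists2 s', s = rcons s' x & subseq s' u.
Proof.
case/lastP: s => [|s y]; first by left; apply: sub0seq.
rewrite -subseq_rev !rev_rcons /=; case: eqP => [->|_] sub; [right|left].
  by exists s; rewrite // -subseq_rev.
by rewrite -subseq_rev rev_rcons.
Qed.

Lemma subseq_rcons2 (T : eqType) (s u : seq T) x :
  subseq s u -> subseq (rcons s x) (rcons u x).
Proof. by move=> su; rewrite -!cats1; apply: cat_subseq. Qed.

Lemma asc_rcons y s x : asc (rcons (y :: s) x) = asc (y :: s) + (last y s < x).
Proof.
rewrite /asc; elim: s y => [|z s IH] y /=; first by rewrite addn0.
by move: (IH z) => /= ->; rewrite addnA.
Qed.

Lemma asc_lt_size s : s != [::] -> asc s < size s.
Proof.
case: s => // y s _; rewrite ltnS /asc.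
by apply: leq_trans (count_size _ _) _; rewrite size_zip /= geq_minr.
Qed.

Lemma is_ascent_seqP x : reflect
  (forall i, i < size x ->
     nth 0 x i <= (if i == 0 then 0 else (asc (take i x)).+1))
  (is_ascent_seq x).
Proof.
apply: (iffP forallP) => [h i ix|h [i ix] /=]; last exact: h.
exact: (h (Ordinal ix)).
Qed.

Lemma is_ascent_seq_rcons u x : u != [::] ->
  is_ascent_seq (rcons u x) = is_ascent_seq u && (x <= (asc u).+1).
Proof.
move=> u0; have su : 0 < size u by case: u u0.
apply/is_ascent_seqP/andP => [h|[/is_ascent_seqP h ux] i].
  split; last first.
    have := h (size u); rewrite size_rcons ltnS nth_rcons ltnn eqxx.
    by rewrite -cats1 take_size_cat // eqn0Ngt su; apply.
  apply/is_ascent_seqP => i iu; have := h i.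
  rewrite size_rcons nth_rcons iu -cats1 takel_cat ?(ltnW iu) //.
  by apply; apply: ltnW.
rewrite size_rcons ltnS leq_eqVlt nth_rcons => /predU1P[->|iu].
  by rewrite ltnn eqxx -cats1 take_size_cat // eqn0Ngt su.
by rewrite iu -cats1 takel_cat ?(ltnW iu) //; apply: h.
Qed.

Lemma is_ascent_seq_catl u v : is_ascent_seq (u ++ v) -> is_ascent_seq u.
Proof.
move/is_ascent_seqP => h; apply/is_ascent_seqP => i iu; have := h i.
rewrite size_cat nth_cat iu takel_cat ?(ltnW iu) //; apply.
by rewrite ltn_addr.
Qed.

(** A nonempty prefix of length [i] has fewer than [i] ascents, so the letter at index [i] is at
    most [i]. This is what lets a word be lifted to a tuple over ['I_n]. *)
Lemma is_ascent_seq_lt_size x : is_ascent_seq x -> all (ltn^~ (size x)) x.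
Proof.
move/is_ascent_seqP => h; apply/(all_nthP 0) => i ix /=.
apply: leq_ltn_trans (h i ix) _; case: eqP => [|/eqP i0]; first lia.
apply: (leq_ltn_trans _ ix); rewrite -[i in leqRHS](size_takel (ltnW ix)).
by apply: asc_lt_size; rewrite -size_eq0 size_takel // ltnW.
Qed.

(* A formulation of "restricted growth function" that is stable under [rcons]:
   below the first letter of any subsequence, every smaller letter can be
   prepended. *)
Definition rgf (u : seq nat) :=
  forall b x s, b < x -> subseq (x :: s) u -> subseq (b :: x :: s) u.

Lemma rgf_rcons u y : rgf u -> (forall b, b < y -> b \in u) -> rgf (rcons u y).
Proof.
move=> ru yu b x s bx /subseq_rconsP[sub|[[|z s'] /= [ex es] sub]].
- exact: subseq_trans (ru _ _ _ bx sub) (subseq_rcons _ _).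
- rewrite {}es; subst x; apply: (subseq_rcons2 (s := [:: b])).
  by rewrite sub1seq yu.
- rewrite {}es; subst x.
  exact: (subseq_rcons2 (s := [:: b, z & s']) y (ru _ _ _ bx sub)).
Qed.

Lemma rgf_contains0101 u :
  rgf u -> contains u [:: 0; 1; 0; 1] = contains u [:: 1; 0; 1].
Proof.
move=> ru; apply/contains0101P/contains101P => -[x [y [yx sub]]].
  by exists x, y; split=> //; apply: subseq_trans sub; apply: subseq_cons.
by exists x, y; split=> //; apply: ru.
Qed.

Lemma rgf_contains0120 u :
  rgf u -> contains u [:: 0; 1; 2; 0] = contains u [:: 1; 2; 0].
Proof.
move=> ru; apply/contains0120P/contains120P => -[x [y [z [zx xy sub]]]].
  by exists x, y, z; split=> //; apply: subseq_trans sub; apply: subseq_cons.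
by exists x, y, z; split=> //; apply: ru.
Qed.

(** The condition under which [x] can be appended without completing a 101. An occurrence of [x]
    followed by a smaller letter kills [x] for good; an absent letter is alive. *)
Definition alive (x : nat) (u : seq nat) :=
  pairwise (fun y z => ~~ ((y == x) && (z < x))) u.

Lemma alive_rcons x u y :
  alive x (rcons u y) = ~~ ((x \in u) && (y < x)) && alive x u.
Proof.
rewrite /alive pairwise_rcons; congr (_ && _); apply/allP/idP => [h|h z zu].
  by apply/andP => -[xu yx]; have := h _ xu; rewrite /= eqxx yx.
by apply: contra h => /andP[/eqP <- ->]; rewrite zu.
Qed.

Lemma pairwise_subseqP (T : eqType) (r : rel T) (w : seq T) :
  reflect (forall x y, subseq [:: x; y] w -> r x y) (pairwise r w).
Proof.
elim: w => [|a w IH] /=; first by apply: ReflectT.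
apply: (iffP andP) => [[/allP aw /IH pw] x y|h].
  by case: eqP => [->|_ /pw //]; rewrite sub1seq => /aw.
split; first by apply/allP => y yw; apply: h; rewrite eqxx sub1seq.
apply/IH => x y sub; apply: h; case: eqP => // _.
by rewrite sub1seq; apply: (mem_subseq sub); rewrite !inE eqxx orbT.
Qed.

Lemma aliveP x u :
  reflect (forall b, b < x -> ~~ subseq [:: x; b] u) (alive x u).
Proof.
apply: (iffP (pairwise_subseqP _ _)) => [h b bx|h y z sub].
  by apply/negP => /h; rewrite eqxx bx.
by apply/andP => -[/eqP yx zx]; have := h _ zx; rewrite -yx sub.
Qed.

Lemma alive_notin x u : x \notin u -> alive x u.
Proof.
move=> xu; apply/aliveP => b _; apply: contra xu => /mem_subseq; apply.
by rewrite inE eqxx.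
Qed.

(** A last letter below [x] would have killed it. Hence repeating a live letter creates no ascent,
    which keeps [asc] equal to the maximum. *)
Lemma alive_last x y u : alive x (y :: u) -> x \in y :: u -> x <= last y u.
Proof.
rewrite (lastI y u) alive_rcons mem_rcons inE; case: eqP => [->|_] //=.
by move=> /andP[h _] xu; move: h; rewrite xu /= -leqNgt.
Qed.

Lemma contains101_rcons u x :
  contains (rcons u x) [:: 1; 0; 1] = contains u [:: 1; 0; 1] || ~~ alive x u.
Proof.
apply/idP/idP => [/contains101P[a [b [ba /subseq_rconsP[sub|]]]]|].
- by apply/orP; left; apply/contains101P; exists a, b.
- case=> -[|a' [|b' [|c' [|]]]] //= [<- <- <-] sub.
  by apply/orP; right; apply/aliveP => /(_ _ ba); rewrite sub.
apply: contraTT => nc; rewrite negb_or negbK; apply/andP; split.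
  by apply: contra nc; apply: contains_subseq; apply: subseq_rcons.
apply/aliveP => b bx; apply: contra nc => sub; apply/contains101P.
by exists x, b; split=> //; apply: (subseq_rcons2 (s := [:: x; b]) x).
Qed.

(** In a new 120 ending in [x], the first letter lies strictly between [x] and a letter that is at
    most [m]. Conversely, [x.+1] occurs before [m] by [rgf], and the two complete a 120 with [x]. *)
Lemma contains120_rcons u x m : rgf u -> (forall y, (y \in u) = (y <= m)) ->
  contains (rcons u x) [:: 1; 2; 0] = contains u [:: 1; 2; 0] || (x.+1 < m).
Proof.
move=> ru mu; apply/contains120P/orP => [|[/contains120P|xm]].
- case=> [a [b [c [ca ab /subseq_rconsP[sub|]]]]].
    by left; apply/contains120P; exists a, b, c.
  case=> -[|a' [|b' [|c' [|]]]] //= [<- <- <-] sub; right.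
  have : b \in u by apply: (mem_subseq sub); rewrite !inE eqxx orbT.
  rewrite mu; lia.
- case=> [a [b [c [ca ab sub]]]]; exists a, b, c; split=> //.
  exact: subseq_trans sub (subseq_rcons _ _).
exists x.+1, m, x; split=> //; apply: (subseq_rcons2 (s := [:: x.+1; m]) x).
by apply: ru; rewrite // sub1seq mu.
Qed.

(* The maximal letter [m] of [u] together with the liveness of [m] and [m - 1]
   decides which one-letter extensions of [u] are allowed. *)
Record has_state (u : seq nat) (m : nat) (p q : bool) : Prop := HasState {
  state_mem : forall x, (x \in u) = (x <= m);
  state_asc : asc u = m;
  state_rgf : rgf u;
  state_top : p = alive m u;
  state_sub : q = (0 < m) && alive m.-1 u }.

(** [p] and [q] tell whether [m] and [m - 1] may still be used. A new maximum turns the old [p] into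
    [q]; the letter [m - 1] kills [m] and stays alive itself. The test [x.+1 == m] rules out this
    last move when [m = 0]. *)
Fixpoint run (m : nat) (p q : bool) (w : seq nat) : bool :=
  if w is x :: w' then
    if x == m.+1 then run m.+1 true p w'
    else if x == m then p && run m p q w'
    else if x.+1 == m then q && run m false q w'
    else false
  else true.

Lemma has_state0 : has_state [:: 0] 0 true false.
Proof.
split=> // [x|b x s bx]; first by rewrite inE leqn0.
by rewrite /= ; case: x bx.
Qed.

Lemma has_state_succ u m p q :
  has_state u m p q -> has_state (rcons u m.+1) m.+1 true p.
Proof.
case=> mu au ru ep eq; split.
- by move=> x; rewrite mem_rcons inE mu [RHS]leq_eqVlt ltnS.
- case: u mu au {ru ep eq} => [|y u] mu au; first by have := mu 0; rewrite leq0n.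
  by rewrite asc_rcons au ltnS -mu mem_last addn1.
- by apply: rgf_rcons => // b; rewrite mu.
- by rewrite alive_rcons mu ltnn /= alive_notin // mu ltnn.
- by rewrite alive_rcons mu /= leqnn ltnNge leqnSn /= ep.
Qed.

Lemma asc_rcons_alive u x :
  x \in u -> alive x u -> asc (rcons u x) = asc u.
Proof.
case: u => // y u xu ax; rewrite asc_rcons ltnNge alive_last //.
by rewrite addn0.
Qed.

Lemma has_state_same u m q :
  has_state u m true q -> has_state (rcons u m) m true q.
Proof.
case=> mu au ru ep eq; split.
- by move=> x; rewrite mem_rcons inE mu; case: eqP => // ->; rewrite leqnn.
- by rewrite asc_rcons_alive // mu.
- by apply: rgf_rcons => // b bm; rewrite mu ltnW.
- by rewrite alive_rcons ltnn andbF.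
- by rewrite alive_rcons [m < _]ltnNge leq_pred andbF.
Qed.

Lemma has_state_pred u m p :
  has_state u m.+1 p true -> has_state (rcons u m) m.+1 false true.
Proof.
case=> mu au ru ep eq; split.
- by move=> x; rewrite mem_rcons inE mu; case: eqP => // ->; rewrite leqnSn.
- by rewrite asc_rcons_alive // mu.
- by apply: rgf_rcons => // b bm; rewrite mu; apply: ltnW; apply: ltnW.
- by rewrite alive_rcons ltnSn mu leqnn.
- by rewrite alive_rcons ltnn andbF.
Qed.

(** The moves are relative to the maximum, so the number of accepted words depends only on the two
    flags. *)
Fixpoint run_count n (p q : bool) : nat :=
  if n is n'.+1 then
    run_count n' true p + ((if p then run_count n' p q else 0)
                           + (if q then run_count n' false q else 0))
  else 1.

Lemma has_card_cons (Q : pred (seq nat)) n N (x : nat) :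
  has_card (fun w => (size w == n) && Q w) N ->
  has_card (fun w => if w is y :: w' then (y == x) && ((size w' == n) && Q w')
                     else false) N.
Proof.
apply: (has_card_image (f := cons x)) => [u v _ _ [] //|w].
apply: (iffP idP) => [|[u Pu <-]]; last by rewrite eqxx.
by case: w => // y w /andP[/eqP -> h]; exists w.
Qed.

Lemma has_card_run (n m : nat) (p q : bool) : (q -> 0 < m) ->
  has_card (fun w => (size w == n) && run m p q w) (run_count n p q).
Proof.
elim: n m p q => [|n IH] m p q q0.
  by apply: eq_has_card (has_card1 [::]) => -[].
(* The accepted words are split by their first letter: [m.+1], [m] or [m.-1]. The three classes are
   disjoint because [q] forces [0 < m]. *)
have c1 := has_card_cons m.+1 (IH m.+1 true p (fun=> isT)).
have c2 : has_card
    (fun w => p && if w is y :: w' then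
       (y == m) && ((size w' == n) && run m p q w') else false)
    (if p then run_count n p q else 0).
  by case: p {c1}; [apply: has_card_cons; apply: IH|apply: has_card0].
have c3 : has_card
    (fun w => q && if w is y :: w' then
       (y == m.-1) && ((size w' == n) && run m false q w') else false)
    (if q then run_count n false q else 0).
  by case: q q0 {c1 c2} => q0; [apply: has_card_cons; apply: IH|apply: has_card0].
apply: eq_has_card (has_cardU _ c1 (has_cardU _ c2 c3)).
- case=> [|x w] /=; first by rewrite !andbF.
  rewrite eqSS; case: (x =P m.+1) => [->|n1] /=.
    have -> : (m.+1 == m) = false by lia.
    have -> : (m.+1 == m.-1) = false by lia.
    by rewrite /= !andbF !orbF.
  case: (x =P m) => [->|n2] /=.
    case: q q0 {c1 c2 c3} => q0; last by case: p; rewrite ?andbF ?orbF.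
    have -> : (m == m.-1) = false by have := q0 isT; lia.
    by case: p; rewrite ?andbF ?orbF.
  rewrite andbF /=; case: q q0 {c1 c2 c3} => q0 /=; last by rewrite if_same andbF.
  have -> : (x == m.-1) = (x.+1 == m) by have := q0 isT; lia.
  by case: eqP; rewrite ?andbF.
- case=> [|x w]; first by rewrite !andbF.
  by case: (x =P m.+1) => //= -> _; case: (p); case: (q) => //=; lia.
- case=> [|x w]; first by rewrite !andbF.
  case/andP => _ /andP[/eqP -> _]; case: (q) q0 => //= q0.
  by have := q0 isT; lia.
Qed.

(** * Avoiding ascent sequences as accepted words *)

Section AvoidingAscentSequences.

Variable P : seq (seq nat).
(** Both pattern sets of the theorem satisfy this, so one argument counts both families. *)
Hypothesis rgf_avoids : forall u, rgf u ->
  avoids_all P u = ~~ contains u [:: 1; 0; 1] && ~~ contains u [:: 1; 2; 0].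

Let good u := is_ascent_seq u && avoids_all P u.

Lemma good_catl u v : good (u ++ v) -> good u.
Proof.
move=> /andP[/is_ascent_seq_catl au av]; rewrite /good au.
exact: avoids_all_subseq (prefix_subseq u v) av.
Qed.

(** The ascent bound gives [x <= m.+1], which keeps the word [rgf]; then 120 excludes [x.+1 < m] and
    101 excludes dead letters. The letter [m.+1] is fresh, hence alive. *)
Lemma good_rcons u m p q x : has_state u m p q -> good u ->
  good (rcons u x) = [|| x == m.+1, (x == m) && p | (x.+1 == m) && q].
Proof.
move=> st /andP[au av]; have [mu asu ru ep eq] := st.
have u0 : u != [::] by case: (u) (mu 0) => //; rewrite in_nil.
rewrite /good is_ascent_seq_rcons // au asu /=.
case: (leqP x m.+1) => [xm|]; last by lia.
rewrite rgf_avoids; last first.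
  by apply: rgf_rcons => // b bx; rewrite mu -ltnS (leq_trans bx).
rewrite (contains120_rcons _ ru mu) contains101_rcons !negb_or negbK.
move: av; rewrite (rgf_avoids ru) => /andP[-> ->] /=; rewrite -leqNgt.
case: (ltngtP x m.+1) xm => // [xm _|-> _]; last first.
  by rewrite alive_notin ?mu ?ltnn // -ltnS ltnW.
case: (ltngtP x m) => [{}xm|mx|->]; [|lia|rewrite -ep leqnSn; lia].
rewrite eq; case: eqP => [e|]; last lia.
by rewrite -e /= leqnn andbT.
Qed.

Lemma good_run u m p q w : has_state u m p q -> good u ->
  good (u ++ w) = run m p q w.
Proof.
elim: w u m p q => [|x w IH] u m p q st gu /=; first by rewrite cats0.
rewrite -cat_rcons; have gx := good_rcons x st gu.
case: eqP => [ex|nx1].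
  subst x; apply: IH; first exact: has_state_succ st.
  by rewrite gx eqxx.
case: eqP => [ex|nx2].
  subst x; case: p st gx => [] st gx.
    by apply: IH; [apply: has_state_same | rewrite gx eqxx orbT].
  (* A rejected letter makes a prefix bad, and no continuation can repair a bad prefix. *)
  apply/negP => /good_catl; rewrite gx eqxx; lia.
case: eqP => [ex|nx3].
  subst m; case: q st gx => [] st gx.
    by apply: IH; [apply: has_state_pred st| rewrite gx eqxx !orbT].
  apply/negP => /good_catl; rewrite gx; lia.
by apply/negP => /good_catl; rewrite gx; lia.
Qed.

Lemma good_head x w : good (x :: w) = (x == 0) && run 0 true false w.
Proof.
case: eqP => [->|x0]; last first.
  by apply/negP => /andP[/is_ascent_seqP /(_ 0 isT)] /=; lia.
rewrite -cat1s (good_run _ has_state0) //; apply/andP; split.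
  by apply/is_ascent_seqP => -[|].
have [_ _ r0 _ _] := has_state0; rewrite rgf_avoids //.
apply/andP; split; apply/negP.
  by case/contains101P => x' [y [_ /size_subseq]].
by case/contains120P => x' [y [z [_ _ /size_subseq]]].
Qed.

Lemma a_P_run_count n : a_P P n.+1 = run_count n true false.
Proof.
rewrite /a_P cardsE.
apply: (@card_has_card _ _ _ (fun t : n.+1.-tuple 'I_n.+1 => map val t)
  (fun w => if w is y :: w' then
     (y == 0) && ((size w' == n) && run 0 true false w') else false)).
- by move=> s t /(inj_map val_inj) /val_inj.
- move=> w; apply: (iffP idP) => [|[t]]; last first.
    move: (size_tuple t) => + + <-; case: (tval t) => //= y s [sz].
    by rewrite -/(good _) good_head size_map sz eqxx.
  case: w => // x w /and3P[/eqP -> /eqP sz rw].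
  have gw : good (0 :: w) by rewrite good_head eqxx.
  have lt := is_ascent_seq_lt_size (proj1 (andP gw)).
  have sw : size [seq inord y : 'I_n.+1 | y <- 0 :: w] = n.+1.
    by rewrite size_map /= sz.
  have ew : map val [seq inord y : 'I_n.+1 | y <- 0 :: w] = 0 :: w.
    rewrite -map_comp -[RHS]map_id; apply/eq_in_map => y yw /=.
    by rewrite inordK //; have := allP lt _ yw; rewrite /= sz.
  exists (tcast sw (in_tuple [seq inord y : 'I_n.+1 | y <- 0 :: w])).
    by rewrite val_tcast in_tupleE ew.
  by rewrite val_tcast in_tupleE ew.
- by apply: has_card_cons; apply: has_card_run.
Qed.

End AvoidingAscentSequences.

(** * Permutations *)

Lemma pairwise_catl (T : eqType) (r : rel T) (s t : seq T) :
  (forall x y, y \in t -> r x y) -> pairwise r (s ++ t) = pairwise r s.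
Proof.
move=> rt; rewrite pairwise_cat.
have -> : allrel r s t by apply/allrelP => x y _; apply: rt.
have -> // : pairwise r t; last by rewrite andbT.
apply/pairwise_subseqP => x y sub; apply: rt; apply: (mem_subseq sub).
by rewrite !inE eqxx orbT.
Qed.

Fixpoint triplewise (T : Type) (r : T -> rel T) (w : seq T) : bool :=
  if w is a :: w' then pairwise (r a) w' && triplewise r w' else true.

Lemma subseq_consP (T : eqType) (x a : T) (s w : seq T) :
  reflect (x = a /\ subseq s w \/ subseq (x :: s) w)
          (subseq (x :: s) (a :: w)).
Proof.
rewrite /=; apply: (iffP idP) => [|[[-> sub]|sub]].
- by case: eqP => [->|_] sub; [left | right].
- by rewrite eqxx.
case: eqP => // _; apply: subseq_trans sub; exact: subseq_cons.
Qed.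

Lemma triplewiseP (T : eqType) (r : T -> rel T) (w : seq T) :
  reflect (forall x y z, subseq [:: x; y; z] w -> r x y z) (triplewise r w).
Proof.
elim: w => [|a w IH]; first by apply: ReflectT.
apply: (iffP andP) => [[/pairwise_subseqP aw /IH pw] x y z|h].
  by case/subseq_consP => [[->]|]; [apply: aw|apply: pw].
split.
  by apply/pairwise_subseqP => y z sub; apply: h; apply/subseq_consP; left.
by apply/IH => x y z sub; apply: h; apply/subseq_consP; right.
Qed.

Lemma triplewise_catl (T : eqType) (r : T -> rel T) (s t : seq T) :
  (forall x y z, z \in t -> r x y z) ->
  triplewise r (s ++ t) = triplewise r s.
Proof.
move=> rt; elim: s => [|a s IH] /=; last by rewrite IH pairwise_catl //; apply: rt.
apply/triplewiseP => x y z sub; apply: rt; apply: (mem_subseq sub).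
by rewrite !inE eqxx !orbT.
Qed.

Local Notation no12 := (pairwise (fun x y : nat => ~~ (x < y))).
Local Notation no123 := (triplewise (fun x y z : nat => ~~ (x < y < z))).
Local Notation no231 := (triplewise (fun x y z : nat => ~~ (z < x < y))).

Fixpoint no4123 (w : seq nat) : bool :=
  if w is a :: w' then
    triplewise (fun x y z => ~~ [&& x < y, y < z & z < a]) w' && no4123 w'
  else true.

Lemma no4123P w :
  reflect (forall t x y z, subseq [:: t; x; y; z] w ->
                           ~~ [&& x < y, y < z & z < t])
          (no4123 w).
Proof.
elim: w => [|a w IH]; first by apply: ReflectT.
apply: (iffP andP) => [[/triplewiseP aw /IH pw] t x y z|h].
  by case/subseq_consP => [[->]|]; [apply: aw|apply: pw].
split.
  by apply/triplewiseP => x y z sub; apply: h; apply/subseq_consP; left.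
by apply/IH => t x y z sub; apply: h; apply/subseq_consP; right.
Qed.

Lemma contains120_no231 w : contains w [:: 1; 2; 0] = ~~ no231 w.
Proof.
apply: negb_inj; rewrite negbK; apply/idP/triplewiseP => [nc x y z sub|h].
  apply: contra nc => /andP[zx xy]; apply/contains120P; exists x, y, z; split=> //.
apply/contains120P => -[x [y [z [zx xy /h]]]]; by rewrite zx xy.
Qed.

Lemma contains3012_no4123 w : contains w [:: 3; 0; 1; 2] = ~~ no4123 w.
Proof.
apply: negb_inj; rewrite negbK; apply/idP/no4123P => [nc t x y z sub|h].
  by apply: contra nc => /and3P[xy yz zt]; apply/contains3012P; exists t, x, y, z.
by apply/contains3012P => -[t [x [y [z [xy yz zt /h]]]]]; rewrite xy yz zt.
Qed.

(** Two of the three letters of a 123 would lie in the same weakly decreasing factor. *)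
Lemma no12_no123 s t : no12 s -> no12 t -> no123 (s ++ t).
Proof.
move=> + dt; elim: s => [|a s IH] /= => [_|/andP[/allP as_ ds]].
  apply/triplewiseP => x y z sub; move/pairwise_subseqP: dt => /(_ x y).
  rewrite negb_and => -> //; apply: subseq_trans sub; exact: (prefix_subseq [:: x; y]).
rewrite IH // andbT pairwise_cat; apply/and3P; split.
- by apply/allrelP => y z /as_ /negbTE ->.
- apply: sub_pairwise ds => y z; by rewrite negb_and orbC => ->.
- apply: sub_pairwise dt => y z; by rewrite negb_and orbC => ->.
Qed.

Lemma no12_no231 s : no12 s -> no231 s.
Proof.
move/pairwise_subseqP => ds; apply/triplewiseP => x y z sub; rewrite negb_and orbC ds //.
apply: subseq_trans sub; exact: (prefix_subseq [:: x; y]).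
Qed.

(** * Decomposition of a word by its first letter *)

Section Decomposition.

Variables (s t : seq nat).
Hypothesis st : forall x y, x \in s -> y \in t -> x < y.

Lemma no231_cat : no231 (s ++ t) = no231 s && no231 t.
Proof.
elim: s st => [|a s' IH] //= lt; rewrite IH; last first.
  by move=> x y xs; apply: lt; rewrite inE xs orbT.
rewrite pairwise_catl ?andbA // => y z zt.
by rewrite ltnNge (ltnW (lt _ _ (mem_head _ _) zt)).
Qed.

Lemma no4123_cat : no4123 (s ++ t) = no4123 s && no4123 t.
Proof.
elim: s st => [|a s' IH] //= lt; rewrite IH; last first.
  by move=> x y xs; apply: lt; rewrite inE xs orbT.
rewrite triplewise_catl ?andbA // => x y z zt.
by rewrite [z < a]ltnNge (ltnW (lt _ _ (mem_head _ _) zt)) !andbF.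
Qed.

Variable a : nat.
Hypothesis sa : forall x, x \in s -> x < a.
Hypothesis a_lt : forall y, y \in t -> a < y.

(** As the 2 of a 231, [a] would need a larger letter before a smaller one, but all smaller letters
    come first. *)
Lemma no231_cons_cat : no231 (a :: s ++ t) = no231 s && no231 t.
Proof.
rewrite -no231_cat /= pairwise_catl => [|y z /a_lt az].
  have -> // : pairwise (fun y z => ~~ (z < a < y)) s.
  apply/pairwise_subseqP => y z /mem_subseq sub.
  have /sa : y \in s by apply: sub; rewrite inE eqxx.
  lia.
lia.
Qed.

(** With [a] as the 4, the final letter is below [a], so the remaining 123 lies entirely in [s]. *)
Lemma no4123_cons_cat : no4123 (a :: s ++ t) = [&& no123 s, no4123 s & no4123 t].
Proof.
rewrite /= no4123_cat triplewise_catl => [|x y z /a_lt az]; last first.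
  lia.
congr (_ && _); apply/triplewiseP/triplewiseP => h x y z sub.
  apply: contra (h _ _ _ sub) => /andP[-> ->]; apply: sa.
  by apply: (mem_subseq sub); rewrite !inE eqxx !orbT.
by apply: contra (h _ _ _ sub) => /and3P[-> ->].
Qed.

End Decomposition.

Lemma no123_no4123 s : no123 s -> no4123 s.
Proof.
move/triplewiseP => h; apply/no4123P => t x y z /subseqP sub.
have /h : subseq [:: x; y; z] s
  by apply/(subseq_trans (subseq_cons [:: x; y; z] t))/subseqP.
by apply: contra => /and3P[-> ->].
Qed.

(** After the first letter above [a], a letter below [a] would complete a 231. *)
Lemma no231_split a w : uniq (a :: w) -> no231 (a :: w) ->
  w = [seq x <- w | x < a] ++ [seq x <- w | a < x].
Proof.
rewrite /= => /andP[aw _] /andP[pw _]; elim: w aw pw => //= b w IH.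
rewrite inE negb_or => /andP[ab aw] /andP[/allP bw pw].
case: (ltngtP b a) ab => // [ba _|ab _]; first by rewrite /= -IH.
have -> : [seq x <- w | x < a] = [::].
  apply/eqP; rewrite -[_ == _]negbK -has_filter; apply/hasPn => x xw.
  by have := bw _ xw; rewrite ab andbT.
rewrite /=; congr (_ :: _); symmetry; apply/all_filterP/allP => x xw.
have := bw _ xw; rewrite ab andbT -leqNgt leq_eqVlt => /predU1P[ax|//].
by rewrite ax xw in aw.
Qed.

Lemma perm_eq_mem_iota k n w x :
  perm_eq w (iota k n) -> (x \in w) = (k <= x < k + n).
Proof. by move/perm_mem ->; rewrite mem_iota. Qed.

Lemma perm_cons_cat_iota k n j s t : j <= n ->
  perm_eq s (iota k j) -> perm_eq t (iota (k + j).+1 (n - j)) ->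
  perm_eq (k + j :: s ++ t) (iota k n.+1).
Proof.
move=> jn ps pt; have -> : n.+1 = j + (n - j).+1 by rewrite addnS subnKC.
rewrite iotaD /= -cat1s perm_catCA perm_cat //= perm_cons //.
Qed.

Lemma perm_filter_iota k n j w : j <= n ->
  perm_eq (k + j :: w) (iota k n.+1) ->
  perm_eq [seq x <- w | x < k + j] (iota k j) /\
  perm_eq [seq x <- w | k + j < x] (iota (k + j).+1 (n - j)).
Proof.
move=> jn pw; have uw : uniq (k + j :: w) by rewrite (perm_uniq pw) iota_uniq.
have mw x := perm_eq_mem_iota x pw.
have uw' : uniq w by case/andP: uw.
have jw : k + j \notin w by case/andP: uw.
have xj x : x \in w -> x != k + j by move=> xw; apply: contraNneq jw => <-.
split; apply: uniq_perm; rewrite ?filter_uniq ?iota_uniq // => x;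
  have := mw x; have := xj x; rewrite mem_filter mem_iota inE; lia.
Qed.

(** The offset [k] is kept general because the upper factor of a word uses the letters from
    [k + j + 1] on. *)
Definition av_231_123 k n w := [&& perm_eq w (iota k n), no231 w & no123 w].
Definition av_231_4123 k n w := [&& perm_eq w (iota k n), no231 w & no4123 w].

Definition no231_head k n j w :=
  [&& perm_eq w (iota k n.+1), no231 w & head 0 w - k == j].

Lemma no231_headP k n j w : j <= n ->
  reflect (exists s t, [/\ w = k + j :: s ++ t,
     perm_eq s (iota k j) && no231 s &
     perm_eq t (iota (k + j).+1 (n - j)) && no231 t])
  (no231_head k n j w).
Proof.
move=> jn; apply: (iffP and3P) => [[pw nw /eqP hw]|[s [t [-> /andP[ps ns] /andP[pt nt]]]]].
  case: w pw nw hw => [/perm_size //|a w] pw nw /= hw.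
  have ea : a = k + j.
    have := perm_eq_mem_iota a pw; rewrite inE eqxx /=; lia.
  subst a; have uw : uniq (k + j :: w) by rewrite (perm_uniq pw) iota_uniq.
  have ew := no231_split uw nw; have [ps pt] := perm_filter_iota jn pw.
  exists [seq x <- w | x < k + j], [seq x <- w | k + j < x].
  have sub s : subseq s w -> no231 s.
    move=> sw; apply/triplewiseP => x y z sxyz; move/triplewiseP: nw; apply.
    by apply/subseq_consP; right; apply: subseq_trans sw.
  by rewrite -ew ps pt !sub // filter_subseq.
rewrite (perm_cons_cat_iota jn ps pt) addKn; split=> //.
have ms x := perm_eq_mem_iota x ps; have mt x := perm_eq_mem_iota x pt.
rewrite no231_cons_cat ?ns ?nt // => [x y|x|y]; rewrite ?ms ?mt; lia.
Qed.

Definition dec k n := rev (iota k n).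

Lemma no12_sorted w : no12 w = sorted geq w.
Proof.
rewrite sorted_pairwise; last by move=> y x z; rewrite /geq /= => *; lia.
by apply: eq_pairwise => x y; rewrite -leqNgt.
Qed.

Lemma no12_dec k n : no12 (dec k n).
Proof. by rewrite no12_sorted rev_sorted; apply: iota_sorted. Qed.

(** Avoiding 12 means being sorted for [geq], and a sorted arrangement is unique. *)
Lemma no12_perm_iota k n w : perm_eq w (iota k n) -> no12 w -> w = dec k n.
Proof.
move=> pw nw; apply: (sorted_eq (leT := geq)); rewrite -?no12_sorted ?no12_dec //.
- by move=> y x z; rewrite /geq /= => *; lia.
- by move=> x y; rewrite /geq /=; lia.
- by rewrite perm_sym perm_rev perm_sym.
Qed.

Lemma has_card_fibers (T : eqType) (P : pred T) (f : T -> nat) (c : nat -> nat) n :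
  (forall j, j < n -> has_card (fun w => P w && (f w == j)) (c j)) ->
  has_card (fun w => P w && (f w < n)) (\sum_(j < n) c j).
Proof.
elim: n => [|n IH] h.
  by rewrite big_ord0; apply: has_card0 => w; rewrite andbF.
rewrite big_ord_recr /=.
apply: eq_has_card (has_cardU _ (IH _) (h n _)) => //.
- by move=> w; rewrite ltnS [in RHS]leq_eqVlt; case: (P w); rewrite //= orbC.
- by move=> w /andP[_ /ltn_eqF ->]; rewrite andbF.
- by move=> j jn; apply: h; apply: ltnW.
Qed.

Lemma has_card_iota_fibers (P : pred (seq nat)) k n c :
  (forall w, P w -> perm_eq w (iota k n.+1)) ->
  (forall j, j <= n -> has_card (fun w => P w && (head 0 w - k == j)) (c j)) ->
  has_card P (\sum_(j < n.+1) c j).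
Proof.
move=> Pw h; apply: eq_has_card (@has_card_fibers _ _ _ c n.+1 h) => w.
apply: andb_idr => Pw'; have pw := Pw _ Pw'.
case: w pw {Pw'} => [/perm_size //|a w] pw /=.
by have := perm_eq_mem_iota a pw; rewrite inE eqxx /=; lia.
Qed.

(** If the first letter is the largest, the rest is an arbitrary avoider. Otherwise a larger letter
    follows [s] and a smaller one precedes [t], so both are decreasing: one word for each of the [n]
    smaller first letters. *)
Lemma has_card_av_231_123 k n : has_card (av_231_123 k n) ('C(n, 2)).+1.
Proof.
elim: n k => [|n IH] k.
  apply: eq_has_card (has_card1 [::]) => w; rewrite /av_231_123.
  by apply/eqP/and3P => [-> //|[/perm_nilP]].
have -> : ('C(n.+1, 2)).+1 =
          \sum_(j < n.+1) (if j == n :> nat then ('C(n, 2)).+1 else 1).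
  rewrite big_ord_recr /= eqxx (eq_bigr (fun=> 1)) => [|i _].
    by rewrite sum1_card card_ord binS bin1; lia.
  by rewrite ltn_eqF.
apply: (@has_card_iota_fibers _ k n (fun j => if j == n then _ else _))
  => [w /and3P[] //|j jn]; case: eqP => [->{j jn}|/eqP jn'].
  apply: (has_card_image (f := cons (k + n))) (IH k) => [u v _ _ [] //|w].
  apply: (iffP andP) => [[/and3P[pw nw dw] hw]|[s /and3P[ps ns ds] <-]].
    have /(no231_headP _ _ (leqnn n))[s [t]] : no231_head k n n w.
      by rewrite /no231_head pw nw.
    rewrite subnn => -[ew /andP[ps ns] /andP[/perm_size /size0nil et _]].
    subst t; rewrite cats0 in ew; subst w; exists s => //.
    by apply/and3P; split=> //; case/andP: dw.
  rewrite /av_231_123.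
  have /and3P[-> -> ->] : no231_head k n n (k + n :: s).
    apply/(no231_headP _ _ (leqnn n)); exists s, [::].
    by rewrite cats0 ps ns subnn.
  split=> //; rewrite /= ds andbT; apply/pairwise_subseqP => y z sub.
  have : y \in s by apply: (mem_subseq sub); rewrite inE eqxx.
  by rewrite (perm_eq_mem_iota _ ps); lia.
have {jn'} ltjn : j < n by rewrite ltn_neqAle jn'.
apply: eq_has_card (has_card1 (dec k j.+1 ++ dec (k + j).+1 (n - j))) => w.
have decS : dec k j.+1 = k + j :: dec k j by rewrite /dec -addn1 iotaD rev_cat.
have pd i l : perm_eq (dec i l) (iota i l) by rewrite /dec perm_rev.
apply/eqP/andP => [-> {w}|[/and3P[pw nw dw] hw]].
  rewrite /av_231_123 no12_no123 ?no12_dec // andbT decS cat_cons.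
  suff /and3P[-> -> ->] :
    no231_head k n j (k + j :: dec k j ++ dec (k + j).+1 (n - j)) by [].
  apply/(no231_headP _ _ jn); exists (dec k j), (dec (k + j).+1 (n - j)).
  by rewrite !pd !no12_no231 ?no12_dec.
have /(no231_headP _ _ jn)[s [t [ew /andP[ps ns] /andP[pt nt]]]] :
  no231_head k n j w by rewrite /no231_head pw nw.
subst w; move/triplewiseP: dw => dw.
have ms x := perm_eq_mem_iota x ps; have mt x := perm_eq_mem_iota x pt.
rewrite decS /= -(no12_perm_iota ps) -?(no12_perm_iota pt) //.
  apply/pairwise_subseqP => y z sub; have := dw (k + j) y z.
  have -> /= : k + j < y.
    have : y \in t by apply: (mem_subseq sub); rewrite inE eqxx.
    rewrite mt; lia.
  apply; apply: (@cat_subseq _ [:: k + j] [:: y; z] [:: k + j]) => //.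
  exact: subseq_trans sub (suffix_subseq _ _).
(* The witness is the least letter of [t], present because [j < n]; it would extend an ascending
   pair of [s] to a 123. *)
apply/pairwise_subseqP => x y sub; have := dw x y (k + j).+1.
have -> : y < (k + j).+1.
  have : y \in s by apply: (mem_subseq sub); rewrite !inE eqxx orbT.
  rewrite ms; lia.
rewrite andbT; apply; apply: subseq_trans (subseq_cons _ _).
by apply: (@cat_subseq _ [:: x; y] [:: (k + j).+1]); rewrite // sub1seq mt; lia.
Qed.

(** The common value of the counts, indexed by length. The shift accounts for the forced first
    letter 0, after which the automaton starts. *)
Definition av_count n := if n is n'.+1 then run_count n' true false else 1.

(* The three convolutions of [av_count] with [1], [j] and ['C(j, 2)] span the
   same space as the three entries of [run_count]. *)
Lemma av_count_sums n :
  [/\ \sum_(j < n.+1) av_count (n - j) = run_count n false true,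
      run_count n true false + \sum_(j < n.+1) j * av_count (n - j)
        = run_count n true true &
      run_count n false true + \sum_(j < n.+1) 'C(j, 2) * av_count (n - j)
        = run_count n true false].
Proof.
elim: n => [|n [IH0 IH1 IH2]]; first by rewrite !big_ord_recl !big_ord0.
(* Removing the term [j = 0] and applying Pascal's rule expresses each sum at [n.+1] through the
   sums at [n]; the rest is linear arithmetic. *)
have shift (f : nat -> nat) : \sum_(j < n.+2) f j * av_count (n.+1 - j) =
    f 0 * av_count n.+1 + \sum_(j < n.+1) f j.+1 * av_count (n - j).
  by rewrite big_ord_recl; congr (_ + _); apply: eq_bigr => i _.
have addf (f g : nat -> nat) : \sum_(j < n.+1) (f j + g j) * av_count (n - j) =
    \sum_(j < n.+1) f j * av_count (n - j) + \sum_(j < n.+1) g j * av_count (n - j).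
  by rewrite -big_split; apply: eq_bigr => i _; rewrite mulnDl.
have e0 : \sum_(j < n.+1) 1 * av_count (n - j) = \sum_(j < n.+1) av_count (n - j).
  by apply: eq_bigr => i _; rewrite mul1n.
have s0 : \sum_(j < n.+2) av_count (n.+1 - j) =
    av_count n.+1 + \sum_(j < n.+1) av_count (n - j).
  by rewrite big_ord_recl; congr (_ + _); apply: eq_bigr.
have s1 : \sum_(j < n.+2) j * av_count (n.+1 - j) =
    \sum_(j < n.+1) j * av_count (n - j) + \sum_(j < n.+1) av_count (n - j).
  rewrite (shift id) mul0n add0n -e0 -(addf id (fun=> 1)).
  by apply: eq_bigr => i _; rewrite addn1.
have s2 : \sum_(j < n.+2) 'C(j, 2) * av_count (n.+1 - j) =
    \sum_(j < n.+1) 'C(j, 2) * av_count (n - j) + \sum_(j < n.+1) j * av_count (n - j).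
  rewrite (shift (fun j => 'C(j, 2))) mul0n add0n -(addf (fun j => 'C(j, 2)) id).
  by apply: eq_bigr => i _; rewrite binS bin1.
rewrite {}s0 {}s1 {}s2 {shift addf e0}.
move: (\sum_(j < n.+1) _) (\sum_(j < n.+1) j * _) 
  (\sum_(j < n.+1) 'C(j, 2) * _) IH0 IH1 IH2.
by move=> S0 S1 S2 /=; split; lia.
Qed.

Lemma av_count_rec n :
  av_count n.+1 = \sum_(j < n.+1) ('C(j, 2)).+1 * av_count (n - j).
Proof.
have [s0 _ s2] := av_count_sums n.
rewrite /= -s2 -s0 -big_split; apply: eq_bigr => i _.
by rewrite mulSn.
Qed.

(** For a first letter [k + j], the factors [s] and [t] are chosen independently, which gives the
    terms of [av_count_rec]. *)
Lemma has_card_av_231_4123 k n : has_card (av_231_4123 k n) (av_count n).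
Proof.
elim/ltn_ind: n k => -[|n] IH k.
  apply: eq_has_card (has_card1 [::]) => w; rewrite /av_231_4123.
  by apply/eqP/and3P => [-> //|[/perm_nilP]].
rewrite av_count_rec.
apply: (@has_card_iota_fibers _ k n (fun j => ('C(j, 2)).+1 * av_count (n - j)))
  => [w /and3P[] //|j jn].
have IHj : has_card (av_231_4123 (k + j).+1 (n - j)) (av_count (n - j)).
  by apply: IH; rewrite ltnS leq_subr.
apply: (has_card_image (f := fun z => k + j :: z.1 ++ z.2))
  (has_cardX (has_card_av_231_123 k j) IHj).
  move=> [s t] [s' t'] /andP[/and3P[ps _ _] _] /andP[/and3P[ps' _ _] _] /= [] /eqP.
  (* Both first factors have length [j], so the concatenation can be cut in only one place. *)
  rewrite eqseq_cat; first by case/andP => /eqP -> /eqP ->.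
  by rewrite (perm_size ps) (perm_size ps').
move=> w; apply: (iffP andP) => [[/and3P[pw nw fw] hw]|[[s t] /=]].
  have /(no231_headP _ _ jn)[s [t [ew /andP[ps ns] /andP[pt nt]]]] :
    no231_head k n j w by rewrite /no231_head pw nw.
  subst w; exists (s, t) => //=; rewrite /av_231_123 /av_231_4123 ps ns pt nt /=.
  move: fw; rewrite no4123_cons_cat => [/and3P[-> _ ->] //|x y|x|y];
    rewrite ?(perm_eq_mem_iota _ ps) ?(perm_eq_mem_iota _ pt); lia.
case/andP => /and3P[ps ns ds] /and3P[pt nt ft] <-.
have /and3P[pw nw hw] : no231_head k n j (k + j :: s ++ t).
  by apply/(no231_headP _ _ jn); exists s, t; rewrite ps ns pt nt.
split=> //; apply/and3P; split=> //.
rewrite no4123_cons_cat ?ds ?ft ?no123_no4123 // => [x y|x|y];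
  rewrite ?(perm_eq_mem_iota _ ps) ?(perm_eq_mem_iota _ pt); lia.
Qed.

(** * From words back to permutations *)

Lemma perm_word_inj n : injective (@perm_word n).
Proof.
move=> s t /eq_in_map st; apply/permP => i; apply: val_inj.
by have /(_ i) := st; rewrite mem_enum => /(_ isT) [].
Qed.

Lemma perm_eq_perm_word n (s : 'S_n) : perm_eq (perm_word s) (iota 1 n).
Proof.
apply: uniq_perm; rewrite ?iota_uniq //.
  by rewrite map_inj_uniq ?enum_uniq // => i j [] /val_inj /perm_inj.
move=> x; rewrite mem_iota add1n ltnS; apply/mapP/andP => [[i _ ->]|[x0 xn]].
  by split=> //; apply: ltn_ord.
have ltx : x.-1 < n by lia.
exists (s^-1%g (Ordinal ltx)); first by rewrite mem_enum.
by rewrite permKV /= prednK.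
Qed.

Lemma perm_word_surj n w :
  perm_eq w (iota 1 n) -> exists s : 'S_n, perm_word s = w.
Proof.
move=> pw; have sw : size w = n by rewrite (perm_size pw) size_iota.
have wP i : i < n -> 0 < nth 0 w i <= n.
  move=> iltn; have : nth 0 w i \in w by rewrite mem_nth ?sw.
  by rewrite (perm_eq_mem_iota _ pw) add1n ltnS.
have ltf (i : 'I_n) : (nth 0 w i).-1 < n by have := wP i (ltn_ord i); lia.
have injf : injective (fun i : 'I_n => Ordinal (ltf i)).
  move=> i j [] eij; apply: val_inj; apply/eqP => /=.
  have uw : uniq w by rewrite (perm_uniq pw) iota_uniq.
  have := nth_uniq 0 (i := i) (j := j) _ _ uw; rewrite sw => <- //.
  move: eij (wP i (ltn_ord i)) (wP j (ltn_ord j)).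
  by move: (nth 0 w i) (nth 0 w j) => x y; lia.
exists (perm injf); rewrite /perm_word.
transitivity [seq nth 0 w i | i <- map val (enum 'I_n)].
  rewrite -map_comp; apply: eq_map => i; rewrite permE /= prednK //.
  by case/andP: (wP i (ltn_ord i)).
by rewrite val_enum_ord -{1}sw; apply: mkseq_nth.
Qed.

Lemma card_S_231_4123 n : #|S_231_4123 n| = av_count n.
Proof.
rewrite /S_231_4123 cardsE.
apply: (card_has_card (@perm_word_inj n)) (has_card_av_231_4123 1 n) => w.
have avE (s : 'S_n) :
    ~~ perm_contains s [:: 2; 3; 1] && ~~ perm_contains s [:: 4; 1; 2; 3]
    = no231 (perm_word s) && no4123 (perm_word s).
  by rewrite /perm_contains -[red _]/[:: 1; 2; 0]
    -[red [:: 4; 1; 2; 3]]/[:: 3; 0; 1; 2]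
    contains120_no231 contains3012_no4123 !negbK.
apply: (iffP and3P) => [[/perm_word_surj[s <-] nw fw]|[s]].
  by exists s => //; rewrite avE nw.
by rewrite avE => /andP[nw fw] <-; rewrite perm_eq_perm_word.
Qed.

Lemma a_P_0101_0120 n :
  a_P [:: [:: 0; 1; 0; 1]; [:: 0; 1; 2; 0]] n.+1 = run_count n true false.
Proof.
apply: a_P_run_count => u ru.
by rewrite /avoids_all /= andbT rgf_contains0101 // rgf_contains0120.
Qed.

Lemma a_P_101_120 n :
  a_P [:: [:: 1; 0; 1]; [:: 1; 2; 0]] n.+1 = run_count n true false.
Proof. by apply: a_P_run_count => u _; rewrite /avoids_all /= andbT. Qed.

(** * The generating function *)

Import GRing.Theory.
Local Open Scope ring_scope.

Lemma c_seqE n : c_seq n = Posz (av_count n).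
Proof. by case: n => // n; rewrite /c_seq a_P_0101_0120. Qed.

Lemma coef_denominator k :
  (1 - 4 *: 'X + 5 *: 'X^2 - 3 *: 'X^3 : {poly int})`_k
  = [:: 1; -4; 5; -3]`_k.
Proof.
rewrite !coefE.
by case: k => [|[|[|[|k]]]] //=; rewrite nth_nil.
Qed.

Lemma coef_numerator n :
  ((1 - 'X) ^+ 3 : {poly int})`_n = [:: 1; -3; 3; -1]`_n.
Proof.
have -> : (1 - 'X) ^+ 3 = 1 - 'X *+ 3 + 'X^2 *+ 3 - 'X^3 :> {poly int} by ring.
rewrite !coefE.
by case: n => [|[|[|[|n]]]] //=; rewrite nth_nil.
Qed.

(* The generating-function identity sum_n c(n) x^n = (1-x)^3/(1-4x+5x^2-3x^3)
   is stated as the equivalent identity of formal power series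
   (1-4x+5x^2-3x^3) * sum_n c(n) x^n = (1-x)^3, coefficientwise
   (Cauchy product). *)
Theorem theorem3p4 :
  (forall n : nat, (1 <= n)%N ->
     a_P [:: [:: 0; 1; 0; 1]; [:: 0; 1; 2; 0]]%N n = a_P [:: [:: 1; 0; 1]; [:: 1; 2; 0]]%N n
     /\ a_P [:: [:: 1; 0; 1]; [:: 1; 2; 0]]%N n = #|S_231_4123 n|) /\
  (forall n : nat,
     \sum_(k < n.+1) (1 - 4 *: 'X + 5 *: 'X^2 - 3 *: 'X^3 : {poly int})`_k * c_seq (n - k)
     = ((1 - 'X) ^+ 3 : {poly int})`_n).
Proof.
split=> [[|n] // _|n].
  by rewrite a_P_0101_0120 a_P_101_120 card_S_231_4123.
rewrite coef_numerator.
under eq_bigr => k _ do rewrite coef_denominator c_seqE.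
case: n => [|[|[|[|n]]]]; try by rewrite !big_ord_recl big_ord0.
(* From index 4 on, the claim is the recurrence c(N) = 4c(N-1) - 5c(N-2) + 3c(N-3). All its indices
   are positive, so every term is a [run_count] value and the recurrence follows by unfolding. *)
do 4 rewrite big_ord_recl; rewrite big1 => [|k _].
  rewrite /= nth_nil; lia.
by rewrite /= nth_nil mul0r.
Qed.
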